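(* Let $Q$ be an IP-polygon of maximal local index $m_Q=k\geq 2$. Then \[|\partial Q\cap N|\leq 4k(k+2).\] If $Q$ is an LDP-polygon, then \[|\partial Q\cap N|\leq 4k(k+2)-2.\] If $Q$ is an LDP-polygon and $k\geq 3$ is prime, then \[|\partial Q\cap N|\leq 4k(k+1)-2.\]
   Context: Fix a lattice $N\cong\mathbb{Z}^2$ with dual lattice $M=\mathrm{Hom}(N,\mathbb{Z})$ and pairing $\langle\cdot,\cdot\rangle$. A lattice polygon $Q\subset N\otimes_{\mathbb{Z}}\mathbb{Q}$ (one may equivalently work over $\mathbb{R}$) is the convex hull of finitely many points of $N$, with non-empty interior. $Q$ is an IP-polygon if the origin $\mathbf{0}$ lies in the (strict) interior of $Q$. An IP-polygon is an LDP-polygon if all its vertices are primitive lattice points (no lattice point lies strictly between the origin and a vertex). The facets of $Q$ are its edges. For a facet $F$, $\eta_F\in M$ is the unique primitive lattice point defining an outer normal of $F$, and the local index $l_F:=\langle\eta_F,F\rangle$ is the constant value of $\eta_F$ on $F$ (a positive integer). The maximal local index is $m_Q:=\max\{l_F : F \text{ a facet of } Q\}$. $\partial Q$ is the boundary of $Q$ and $|\cdot|$ is cardinality. *)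

(* Defs.v *)
From HB Require Import structures.
From mathcomp Require Import all_boot all_order all_algebra.
From mathcomp Require Import all_classical all_reals all_analysis.

Set Implicit Arguments.
Unset Strict Implicit.
Unset Printing Implicit Defensive.

Import Order.TTheory GRing.Theory Num.Theory.
Import numFieldNormedType.Exports.

Local Open Scope classical_set_scope.
Local Open Scope ring_scope.

(* The lattice N is 'cV[int]_2, its dual M is 'rV[int]_2, and the pairing is
   the matrix product of a row by a column.  The base field R is any archimedean
   ordered field; R := rat gives N ⊗ Q, and any R : realType gives N ⊗ R. *)

Definition lattice_emb (R : archiRealFieldType) (m n : nat)
  (z : 'M[int]_(m, n)) : 'M[R]_(m, n) := map_mx intr z.

Definition pairing (R : archiRealFieldType) (u : 'rV[R]_2) (x : 'cV[R]_2) : R :=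
  (u *m x) ord0 ord0.

(* Used both for N (columns) and for M (rows). *)
Definition primitive (R : archiRealFieldType) (m n : nat)
    (z : 'M[int]_(m, n)) : Prop :=
  z != 0 /\
  forall (w : 'M[int]_(m, n)) (t : R), 0 < t -> t < 1 ->
    lattice_emb R w <> t *: lattice_emb R z.

Definition conv_hull (R : archiRealFieldType) (A : set 'cV[R]_2) :
    set 'cV[R]_2 :=
  smallest (@convex_set R 'cV[R]_2) A.

Definition lattice_polygon (R : archiRealFieldType) (Q : set 'cV[R]_2) : Prop :=
  (exists s : seq 'cV[int]_2,
     Q = conv_hull [set lattice_emb R z | z in [set` s]]) /\
  interior Q !=set0.

Definition bdry (R : archiRealFieldType) (Q : set 'cV[R]_2) : set 'cV[R]_2 :=
  closure Q `\` interior Q.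

Definition boundary_points (R : archiRealFieldType) (Q : set 'cV[R]_2) :
    set 'cV[int]_2 :=
  [set z | bdry Q (lattice_emb R z)].

Definition supports (R : archiRealFieldType) (Q : set 'cV[R]_2)
    (u : 'rV[R]_2) (c : R) (F : set 'cV[R]_2) : Prop :=
  (forall x, Q x -> pairing u x <= c) /\ F = Q `&` [set x | pairing u x = c].

Definition is_face (R : archiRealFieldType) (Q F : set 'cV[R]_2) : Prop :=
  exists u c, supports Q u c F.

Definition is_vertex (R : archiRealFieldType) (Q : set 'cV[R]_2)
    (v : 'cV[R]_2) : Prop :=
  is_face Q [set v].

(* A proper face that is not empty and not a vertex, i.e. an edge of the
   two-dimensional Q. *)
Definition is_facet (R : archiRealFieldType) (Q F : set 'cV[R]_2) : Prop :=
  [/\ is_face Q F, F <> Q & exists x y, [/\ F x, F y & x != y]].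

Definition IP_polygon (R : archiRealFieldType) (Q : set 'cV[R]_2) : Prop :=
  lattice_polygon Q /\ interior Q 0.

Definition LDP_polygon (R : archiRealFieldType) (Q : set 'cV[R]_2) : Prop :=
  IP_polygon Q /\
  forall v, is_vertex Q v ->
    exists z : 'cV[int]_2, v = lattice_emb R z /\ primitive R z.

(* eta is the (unique) eta_F of the facet F. *)
Definition outer_normal (R : archiRealFieldType) (Q F : set 'cV[R]_2)
    (eta : 'rV[int]_2) : Prop :=
  primitive R eta /\ exists c, supports Q (lattice_emb R eta) c F.

Definition local_index (R : archiRealFieldType) (Q F : set 'cV[R]_2)
    (l : int) : Prop :=
  exists eta, outer_normal Q F eta /\
    forall x, F x -> pairing (lattice_emb R eta) x = l%:~R.

Definition max_local_index (R : archiRealFieldType) (Q : set 'cV[R]_2)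
    (m : int) : Prop :=
  (exists F, is_facet Q F /\ local_index Q F m) /\
  (forall F l, is_facet Q F -> local_index Q F l -> l <= m).

(* Main.v *)
Require Import Defs.
From mathcomp Require Import all_boot all_order all_algebra.
From mathcomp Require Import all_classical all_reals all_analysis.
From mathcomp Require Import zify ring lra.

Set Implicit Arguments.
Unset Strict Implicit.
Unset Printing Implicit Defensive.

Import Order.TTheory GRing.Theory Num.Theory.
Import numFieldNormedType.Exports.

Local Open Scope classical_set_scope.
Local Open Scope ring_scope.

(* Let F be an edge with primitive outer normal eta, at height l <= k, and let
   -h < 0 be the lowest height of Q for eta.  Every line at a height strictly
   between -h and l carries at most two boundary points, so only the lattice
   lengths N and B of Q at the heights l and -h matter.  The slice of Q at
   height 0 lies between -k e and k e, where e is a primitive vector of that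
   line, since an edge cut by the ray of e has a normal taking an integral value
   >= 1 at e and a local index <= k; convexity then gives
   h N + l B <= 2 k (h + l).  If h < k, this bounds the number b of boundary
   points by 2 k (k + 3) - 2.  If h >= k, it gives N <= 4 k; choosing F special,
   i.e. with eta nonnegative on the sum of all boundary points, one gets
   k b <= \sum_z (k + eta z) <= (k + l) (k + l + N), hence b <= 12 k. *)

(** * Plane determinants and lattice bases *)

Definition det2 (R : comNzRingType) (a b : 'cV[R]_2) : R :=
  a ord0 ord0 * b ord_max ord0 - a ord_max ord0 * b ord0 ord0.

Section Det2.
Variable R : comNzRingType.
Implicit Types (a b c d e f z w : 'cV[R]_2) (x : R).

Lemma col2P a b :
  a ord0 ord0 = b ord0 ord0 -> a ord_max ord0 = b ord_max ord0 -> a = b.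
Proof.
move=> h0 h1; apply/colP => -[[|[|//]] i].
- by rewrite (_ : Ordinal i = ord0) //; apply: val_inj.
- by rewrite (_ : Ordinal i = ord_max) //; apply: val_inj.
Qed.

Lemma det2Dl a b c : det2 (a + b) c = det2 a c + det2 b c.
Proof. by rewrite /det2 !mxE; ring. Qed.

Lemma det2Bl a b c : det2 (a - b) c = det2 a c - det2 b c.
Proof. by rewrite /det2 !mxE; ring. Qed.

Lemma det2Zl x a b : det2 (x *: a) b = x * det2 a b.
Proof. by rewrite /det2 !mxE; ring. Qed.

Lemma det2Dr a b c : det2 c (a + b) = det2 c a + det2 c b.
Proof. by rewrite /det2 !mxE; ring. Qed.

Lemma det2Br a b c : det2 c (a - b) = det2 c a - det2 c b.
Proof. by rewrite /det2 !mxE; ring. Qed.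

Lemma det2Zr x a b : det2 b (x *: a) = x * det2 b a.
Proof. by rewrite /det2 !mxE; ring. Qed.

Lemma det20l a : det2 0 a = 0.
Proof. by rewrite /det2 !mxE; ring. Qed.

Lemma det2C a b : det2 a b = - det2 b a.
Proof. by rewrite /det2; ring. Qed.

Lemma det2_sum (I : Type) (r : seq I) (F : I -> 'cV[R]_2) a :
  det2 (\sum_(i <- r) F i) a = \sum_(i <- r) det2 (F i) a.
Proof.
by elim: r => [|i r IH]; rewrite ?big_nil ?det20l// !big_cons det2Dl IH.
Qed.

Lemma det2_plucker a b c d :
  det2 a d * det2 b c = det2 a b * det2 d c + det2 a c * det2 b d.
Proof. by rewrite /det2; ring. Qed.

(** Cramer's rule in the lattice basis [f], [e]: [det2 z e] is the height of [z], and [det2 f z] its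
    position along the line of that height. *)
Lemma det2_basis f e z : det2 f e = 1 -> z = det2 z e *: f + det2 f z *: e.
Proof.
move=> fe; rewrite -[LHS]scale1r -fe.
by apply: col2P; rewrite /det2 !mxE; ring.
Qed.

Lemma det2_shift f e z w :
  det2 f e = 1 -> det2 z e = det2 w e -> z + (det2 f w - det2 f z) *: e = w.
Proof.
move=> fe zw; rewrite [RHS](det2_basis w fe) -zw [X in X + _](det2_basis z fe).
move: (det2 f w) (det2 f z) (det2 z e) => x y i.
by rewrite scalerBl addrACA subrr addr0.
Qed.

End Det2.

Definition col2 (a b : int) : 'cV[int]_2 :=
  \col_i (if i == ord0 then a else b).

Lemma det2_col2 z a b :
  det2 z (col2 a b) = z ord0 ord0 * b - z ord_max ord0 * a.
Proof. by rewrite /det2 !mxE. Qed.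

(** * Edges and primitive directions of finite sets of lattice points *)

Section LatticeDirections.
Implicit Types (s p q v d e f : 'cV[int]_2) (V : seq 'cV[int]_2).

(** On one side of the line of [s], the sign of [det2] orders directions by angle, transitively by
    [det2_plucker]; [d] is the last one. *)
Lemma extreme_direction s V : V != [::] ->
    (forall v, v \in V -> 0 < det2 s v) ->
  exists2 d, d \in V & forall a, a \in V -> 0 <= det2 a d.
Proof.
elim: V => // a V IH _ pos.
have [->|V0] := eqVneq V [::].
  exists a; rewrite ?mem_seq1// => b; rewrite mem_seq1 => /eqP->.
  by rewrite /det2 mulrC subrr.
have [|d dV dmax] := IH V0.
  by move=> v vV; apply: pos; rewrite inE vV orbT.
have pa : 0 < det2 s a by apply: pos; rewrite mem_head.
have pd : 0 < det2 s d by apply: pos; rewrite inE dV orbT.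
have [ad|ad] := leP 0 (det2 a d).
  by exists d => [|b]; rewrite inE ?dV ?orbT// => /predU1P[->|/dmax].
exists a => [|b]; rewrite inE ?eqxx// => /predU1P[->|bV].
  by rewrite /det2 mulrC subrr.
have pb : 0 < det2 s b by apply: pos; rewrite inE bV orbT.
have bd := dmax _ bV.
rewrite -(pmulr_rge0 _ pd) (det2_plucker s b a d).
by rewrite (det2C d a) addr_ge0// mulr_ge0// ?oppr_ge0 ltW.
Qed.

Lemma seq_argmax (T : eqType) (f : T -> int) (r : seq T) : r != [::] ->
  exists2 x, x \in r & forall y, y \in r -> f y <= f x.
Proof.
elim: r => // a r IH _; have [->|r0] := eqVneq r [::].
  by exists a => [|v]; rewrite mem_seq1// => /eqP->.
have [p pr pmax] := IH r0.
have [ap|pa] := leP (f a) (f p).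
  by exists p => [|v]; rewrite inE ?pr ?orbT// => /predU1P[->|/pmax].
exists a => [|v]; rewrite inE ?eqxx// => /predU1P[->//|/pmax vp].
exact: le_trans vp (ltW pa).
Qed.

(* Gift wrapping: [p] is a point of [V] farthest to the left of the line of [s],
   and [q] is the first point met when the parallel to that line through [p] is
   rotated about [p]. *)
Lemma hull_edge s V :
    (exists a b, [/\ a \in V, b \in V & det2 s a < det2 s b]) ->
  exists p q, [/\ p \in V, q \in V, 0 < det2 s (p - q) &
    forall v, v \in V -> det2 v (p - q) <= det2 p (p - q)].
Proof.
move=> [a [b [aV bV ab]]].
have V0 : V != [::] by apply: contraTneq aV => ->.
have [p0 p0V p0max] := seq_argmax (det2 s) V0.
(* Ties among the points farthest from the line of [s] are broken by the scalar product with [s]. *)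
pose dot v := s ord0 ord0 * v ord0 ord0 + s ord_max ord0 * v ord_max ord0.
have [|p] := @seq_argmax _ dot [seq v <- V | det2 s v == det2 s p0].
  apply: contraTneq p0V => E; have := in_nil p0.
  by rewrite -E mem_filter eqxx /= => ->.
rewrite mem_filter => /andP[/eqP sp pV] pmax.
have [||d] := @extreme_direction s [seq p - v | v <- V & det2 s v < det2 s p].
- suff : p - a \in [seq p - v | v <- V & det2 s v < det2 s p].
    by apply: contraTneq => ->.
  apply: (map_f (fun v => p - v)).
  by rewrite mem_filter aV sp (lt_le_trans ab (p0max _ bV)).
- move=> w /mapP[v]; rewrite mem_filter => /andP[sv _] ->.
  by rewrite det2Br subr_gt0.
move=> /mapP[q]; rewrite mem_filter => /andP[sq qV] -> dmax.
have spq : 0 < det2 s (p - q) by rewrite det2Br subr_gt0.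
exists p, q; split=> // v vV; rewrite -subr_ge0 -det2Bl.
have := p0max v vV; rewrite -sp le_eqVlt => /predU1P[sv|sv]; last first.
  by apply: dmax; apply: (map_f (fun v => p - v)); rewrite mem_filter sv.
(* Here [p - v] is parallel to [s], and the tie-break makes it a nonnegative multiple of [s]. *)
have dpv : 0 <= dot p - dot v.
  by rewrite subr_ge0; apply: pmax; rewrite mem_filter sv sp eqxx.
have s0 : 0 < dot s.
  rewrite lt_neqAle eq_sym addr_ge0 -?expr2 ?sqr_ge0// andbT.
  apply: contraTneq ab => /eqP; rewrite paddr_eq0 -?expr2 ?sqr_ge0//.
  by rewrite !sqrf_eq0 => /andP[/eqP z0 /eqP z1]; rewrite /det2 z0 z1 !mul0r.
rewrite -(pmulr_rge0 _ s0).
suff -> : dot s * det2 (p - v) (p - q) = (dot p - dot v) * det2 s (p - q).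
  by rewrite mulr_ge0// ltW.
have -> : dot s * det2 (p - v) (p - q) = (dot p - dot v) * det2 s (p - q)
    - det2 s (p - v) * dot (p - q) by rewrite /dot /det2 !mxE; ring.
by rewrite (det2Br p v) sv subrr mul0r subr0.
Qed.

(** Divide [d] by the gcd of its coordinates; the Bezout coefficients give [f]. The equation
    [det2 f e = 1] is the working form of primitivity. *)
Lemma primitive_part d : d != 0 ->
  exists (g : int) e f, [/\ 0 < g, d = g *: e & det2 f e = 1].
Proof.
move=> d0; set m := d ord0 ord0; set n := d ord_max ord0.
have g0 : gcdz m n != 0.
  rewrite gcdz_eq0; apply: contraNN d0 => /andP[/eqP m0 /eqP n0].
  by apply/eqP; apply: col2P; rewrite mxE.
have [u [v uv]] := Bezoutz m n.
have /dvdzP[m' mE] := dvdz_gcdl m n; have /dvdzP[n' nE] := dvdz_gcdr m n.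
exists (gcdz m n), (col2 m' n'), (col2 v (- u)); split.
- by rewrite lt_neqAle eq_sym g0 /= /gcdz.
- by apply: col2P; rewrite !mxE /= mulrC.
- apply: (mulIf g0); rewrite mul1r -[RHS]uv.
  rewrite [in u * _]mE [in v * _]nE /det2 !mxE /=; ring.
Qed.

End LatticeDirections.

(** * Counting points by height, and the combinatorial bound *)

Section Levels.
Variable T : eqType.
Implicit Types (S : seq T) (y : T -> int).

Lemma sum_by_level S (t : T -> nat) (F : nat -> nat) n :
    (forall z, z \in S -> t z <= n)%N ->
  (\sum_(z <- S) F (t z) =
   \sum_(j < n.+1) F j * count [pred z | t z == j] S)%N.
Proof.
elim: S => [|a S IH] le_n.
  by rewrite big_nil big1// => j _; rewrite muln0.
rewrite big_cons IH => [|z zS]; last by apply: le_n; rewrite inE zS orbT.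
under [RHS]eq_bigr => j _ do rewrite /= mulnDr.
rewrite big_split /=; congr addn.
have lt_ta : (t a < n.+1)%N by rewrite ltnS le_n ?mem_head.
rewrite (bigD1 (Ordinal lt_ta)) //= eqxx muln1 big1 ?addn0// => j.
by rewrite -val_eqE /= eq_sym => /negPf->; rewrite muln0.
Qed.

Lemma count_levels S y (h l : nat) : (0 < h)%N -> (0 < l)%N ->
    (forall z, z \in S -> - h%:Z <= y z <= l%:Z) ->
    (forall i : int, - h%:Z < i < l%:Z ->
       (count [pred z | y z == i] S <= 2)%N) ->
  (size S <= count [pred z | y z == (- h%:Z)%R] S +
             count [pred z | y z == l%:Z] S + 2 * (h + l - 1))%N.
Proof.
move=> h0 l0 yS y2; rewrite -sum1_size.
pose t z := `|(y z + h%:Z)%R|%N.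
rewrite (@sum_by_level S t (fun=> 1%N) (h + l)); last first.
  by move=> z /yS; rewrite /t; lia.
under eq_bigr do rewrite mul1n.
rewrite big_ord_recr -[(h + l)%N]prednK ?addn_gt0 ?h0// big_ord_recl /=.
have cE (i : nat) : count [pred z | t z == i] S =
    count [pred z | y z == i%:Z - h%:Z] S.
  by apply: eq_in_count => z /yS /=; rewrite /t; lia.
rewrite !cE sub0r prednK ?addn_gt0 ?h0// PoszD addrAC subrr add0r.
rewrite -addnA [X in (_ + X <= _)%N]addnC addnA leq_add2l.
apply: (@leq_trans (\sum_(i < (h + l).-1) 2)%N).
  apply: leq_sum => i _; rewrite cE; apply: y2.
  by have := ltn_ord i; rewrite /bump; lia.
by rewrite sum_nat_const card_ord; lia.
Qed.

(** A point at height [i] weighs [k + i]. Two points at each height strictly between [-k] and [l]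
    weigh [(k + l) (k + l - 1)] altogether; the points at height [l] weigh [k + l] each. *)
Lemma weighted_count_levels S y (k l : nat) : (0 < l)%N ->
    (forall z, z \in S -> y z <= l%:Z) ->
    (forall i : int, - k%:Z < i < l%:Z ->
       (count [pred z | y z == i] S <= 2)%N) ->
  k%:Z * (size S)%:Z + \sum_(z <- S) y z <=
    ((k + l) * (k + l - 1 + count [pred z | y z == l%:Z] S))%N%:Z.
Proof.
(* Negative weights are cut off at 0, so level 0 of [t] may hold any number of points. *)
move=> l0 yS y2; pose t z := `|(Num.max 0 (k%:Z + y z))%R|%N.
have -> : k%:Z * (size S)%:Z + \sum_(z <- S) y z = \sum_(z <- S) (k%:Z + y z).
  rewrite big_split /= -sum1_size (big_morph Posz PoszD (erefl _)) mulr_sumr.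
  by congr (_ + _); apply: eq_bigr => i _; rewrite mulr1.
have le_t : \sum_(z <- S) (k%:Z + y z) <= (\sum_(z <- S) t z)%N%:Z.
  rewrite (big_morph Posz PoszD (erefl _)); apply: ler_sum => z _.
  by rewrite /t; lia.
apply: le_trans le_t _; rewrite lez_nat.
rewrite (@sum_by_level S t id (k + l)); last by move=> z /yS; rewrite /t; lia.
have cE (i : nat) : (0 < i)%N -> count [pred z | t z == i] S =
    count [pred z | y z == i%:Z - k%:Z] S.
  move=> i0; apply: eq_count => z /=; rewrite /t; lia.
rewrite big_ord_recr /= mulnDr leq_add//; last first.
  by rewrite cE ?addn_gt0 ?l0 ?orbT// PoszD addrAC subrr add0r.
have -> : ((k + l) * (k + l - 1) = \sum_(i < k + l) i * 2)%N.
  elim: (k + l)%N => [|n IH]; first by rewrite big_ord0.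
  by rewrite big_ord_recr -IH /=; case: n {IH} => [|n]; nia.
apply: leq_sum => i _; have [->//|i0] := posnP i.
rewrite leq_mul2l cE// y2 ?orbT//; have := ltn_ord i; lia.
Qed.

End Levels.

Lemma int_seq_spread (s : seq int) : uniq s -> s != [::] ->
  exists a b, [/\ a \in s, b \in s, (size s)%:Z <= b - a + 1 &
    (2 < size s)%N -> exists2 c, c \in s & a < c < b].
Proof.
move=> us s0.
have [b bs bmax] := seq_argmax (fun x : int => x) s0;
  have [a as' amin] := seq_argmax (fun x : int => - x) s0.
have lea c : c \in s -> a <= c by move=> /amin; rewrite lerN2.
exists a, b; split=> //.
  suff : (size s <= size [seq (a + i%:Z)%R | i <- iota 0 `|(b - a + 1)%R|%N])%N.
    by rewrite size_map size_iota; have := lea _ bs; lia.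
  apply: uniq_leq_size us _ => c cs.
  have -> : c = a + `|(c - a)%R|%N by have := lea _ cs; lia.
  apply: map_f; rewrite mem_iota.
  by have := lea _ cs; have := bmax _ cs; rewrite /=; lia.
move=> s2; apply: contrapT => noc.
suff : (size s <= size [:: a; b])%N by rewrite leqNgt s2.
apply: uniq_leq_size us _ => c cs; rewrite !inE; apply/negP => /negP.
rewrite negb_or => /andP[ca cb]; apply: noc; exists c => //.
by rewrite !lt_neqAle lea//= bmax// eq_sym ca cb.
Qed.

(** Points of one height are told apart by [det2 f], so their positions are distinct integers. The
    last clause serves to exclude three boundary points at an intermediate height. *)
Lemma level_points (S : seq 'cV[int]_2) (e f : 'cV[int]_2) (i : int) :
    uniq S -> det2 f e = 1 -> (0 < count [pred z | det2 z e == i] S)%N ->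
  exists a b, [/\ a \in S, b \in S, det2 a e = i, det2 b e = i &
    (count [pred z | det2 z e == i] S)%:Z <= det2 f b - det2 f a + 1 /\
    ((2 < count [pred z | det2 z e == i] S)%N -> exists c,
       [/\ c \in S, det2 c e = i & det2 f a < det2 f c < det2 f b])].
Proof.
move=> uS fe; rewrite -size_filter; set L := (X in size X) => L0.
have LP z : z \in L -> z \in S /\ det2 z e = i.
  by rewrite mem_filter => /andP[/eqP].
have uL : uniq (map (det2 f) L).
  rewrite map_inj_in_uniq ?filter_uniq// => z w /LP[_ zi] /LP[_ wi] zw.
  by rewrite (det2_basis z fe) (det2_basis w fe) zi wi zw.
have [|_ [_ [/mapP[a aL ->] /mapP[b bL ->]]]] := int_seq_spread uL.
  by rewrite -size_eq0 size_map -lt0n.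
rewrite size_map => ab mid.
have [[aS ai] [bS bi]] := (LP _ aL, LP _ bL).
exists a, b; split=> //; split=> // /mid[_ /mapP[c /LP[cS ci] ->] acb].
by exists c.
Qed.

(** [N] and [B] are the lattice lengths at the top and bottom heights, [n1] and [n2] the numbers of
    boundary points there, and [b] the total number. *)
Lemma boundary_arith (k l h b n1 n2 : nat) (N B : int) :
    (2 <= k)%N -> (0 < l <= k)%N -> (0 < h)%N -> 0 <= N -> 0 <= B ->
    n1%:Z <= N + 1 -> n2%:Z <= B + 1 ->
    h%:Z * N + l%:Z * B <= 2 * k%:Z * (h + l)%N%:Z ->
    (b <= n2 + n1 + 2 * (h + l - 1))%N ->
    ((k <= h)%N -> (k * b <= (k + l) * (k + l - 1 + n1))%N) ->
  (b <= maxn (12 * k) (2 * k * (k + 3) - 2))%N.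
Proof.
move=> k2 /andP[l0 lk] h0 N0 B0 n1N n2B wid b1 b2.
rewrite leq_max; have [kh|hk] := leqP k h; apply/orP; [left|right].
  have N4 : N <= 4 * k%:Z.
    rewrite -(ler_pM2l (_ : 0 < h%:Z)) ?ltz_nat//.
    have : 0 <= l%:Z * B by rewrite mulr_ge0.
    have : (k * (h + l) <= k * (2 * h))%N by rewrite leq_mul2l; lia.
    move: wid; clear; lia.
  have kb : (k * b <= (2 * k) * (6 * k))%N.
    by apply: leq_trans (b2 kh) (leq_mul _ _); lia.
  by rewrite -(leq_pmul2l (_ : 0 < k)%N); nia.
(* With [m] the smaller of [h] and [l]: [m (N + B) <= 2 k (h + l) <= 2 k m (k + 1)]. *)
have NB : N + B <= 2 * k%:Z * (k%:Z + 1).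
  have [lh|hl] := leqP l h.
    rewrite -(ler_pM2l (_ : 0 < l%:Z)) ?ltz_nat//.
    have : 0 <= (h%:Z - l%:Z) * N by apply: mulr_ge0; lia.
    have : (k * (h + l) <= k * (l * (k + 1)))%N.
      rewrite leq_mul2l mulnDr muln1 leq_add2r.
      by rewrite (leq_trans (ltnW hk)) ?orbT// leq_pmull.
    move: wid; clear; lia.
  rewrite -(ler_pM2l (_ : 0 < h%:Z)) ?ltz_nat//.
  have : 0 <= (l%:Z - h%:Z) * B by apply: mulr_ge0; lia.
  have : (k * (h + l) <= k * (h * (k + 1)))%N.
    rewrite leq_mul2l mulnDr muln1 addnC leq_add2r.
    by rewrite (leq_trans lk) ?orbT// leq_pmull.
  move: wid; clear; lia.
clear wid b2; lia.
Qed.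

(* [K] stands for the lattice points of the closure of Q, and [S] lists those on
   its boundary.  Using the closure avoids proving that Q is closed, for which
   compactness is not available over an incomplete field such as rat. *)
Lemma lattice_bound (k : nat) (K : 'cV[int]_2 -> Prop) (S : seq 'cV[int]_2) :
    (2 <= k)%N -> uniq S -> (forall z, z \in S -> K z) ->
    (forall s, s != 0 -> exists e f (l : int), [/\ det2 f e = 1,
       0 < det2 s e, 0 < l <= k%:Z, forall z, K z -> det2 z e <= l &
       exists2 p, K p & det2 p e = l]) ->
    (forall e, e != 0 -> exists v, [/\ K v, det2 v e < 0 &
       forall z, K z -> det2 v e <= det2 z e]) ->
    (forall e f b x y p v, det2 f e = 1 -> 0 < x -> 0 < y ->
       K (b - x *: e) -> b \in S -> K (b + y *: e) -> K p -> K v ->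
       det2 v e < det2 b e < det2 p e -> False) ->
  (size S <= maxn (12 * k) (2 * k * (k + 3) - 2))%N.
Proof.
move=> k2 uS SK facet lower mid.
have [e [f [l' [fe se l'k Kl [p Kp pl]]]]] : exists e f (l : int),
    [/\ det2 f e = 1, 0 <= det2 (\sum_(z <- S) z) e, 0 < l <= k%:Z,
        forall z, K z -> det2 z e <= l & exists2 p, K p & det2 p e = l].
  (* If the boundary points sum to 0, every facet is special, and [const_mx 1] is an arbitrary
     direction. *)
  have [->|s0] := eqVneq (\sum_(z <- S) z) 0.
    have [|e [f [l [? ? ? ? ?]]]] := facet (const_mx 1).
      by apply/eqP => /matrixP/(_ ord0 ord0); rewrite !mxE.
    by exists e, f, l; split; rewrite ?det20l.
  have [e [f [l [? se ? ? ?]]]] := facet _ s0.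
  by exists e, f, l; split; rewrite // ltW.
have e0 : e != 0.
  by apply: contra_eq_neq fe => ->; rewrite det2C det20l oppr0 eq_sym oner_eq0.
have [v [Kv v0 Kv_min]] := lower e e0.
have [l lE] : exists l : nat, l' = l%:Z by exists `|l'|%N; lia.
have [h hE] : exists h : nat, det2 v e = - h%:Z by exists `|det2 v e|%N; lia.
rewrite {l'}lE in l'k Kl pl; rewrite hE in v0 Kv_min.
have level2 (i : int) : - h%:Z < i < l%:Z ->
    (count [pred z | det2 z e == i] S <= 2)%N.
  (* Of three boundary points on the line, the middle one contradicts [mid]. *)
  move=> il; rewrite leqNgt; apply/negP => gt2.
  have [|a [c [aS cS ai ci [_ /(_ gt2)[b [bS bi /andP[ab bc]]]]]]] :=
    level_points (i := i) uS fe; first exact: leq_ltn_trans gt2.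
  apply: (@mid e f b (det2 f b - det2 f a) (det2 f c - det2 f b) p v);
    rewrite ?subr_gt0//.
  - suff -> : b - (det2 f b - det2 f a) *: e = a by exact: SK.
    by rewrite -scaleNr opprB det2_shift// ai.
  - suff -> : b + (det2 f c - det2 f b) *: e = c by exact: SK.
    by rewrite det2_shift// ci.
  - by rewrite hE bi pl.
have spread (i : int) p' : K p' -> det2 p' e = i -> exists a b, [/\ K a, K b,
    det2 a e = i, det2 b e = i & 0 <= det2 f b - det2 f a /\
    (count [pred z | det2 z e == i] S)%:Z <= det2 f b - det2 f a + 1].
  (* Without boundary points at height [i], the segment from [p'] to itself will do. *)
  move=> Kp' p'i; have [->|] := posnP (count [pred z | det2 z e == i] S).
    by exists p', p'; split=> //; rewrite subrr.
  move=> /[dup] c0 /(level_points uS fe)[a [b [/SK ? /SK ? ? ? [? _]]]].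
  by exists a, b; split=> //; lia.
have [a [a' [Ka Ka' al a'l [aa0 aa]]]] := spread _ _ Kp pl.
have [b [b' [Kb Kb' bh b'h [bb0 bb]]]] := spread _ _ Kv hE.
(* The segment joining a top point to a bottom point meets the line of level
   [0] at a multiple of [e], whose size is bounded by the facet cutting the ray
   through [e]. *)
have width (u : int) c d : u * u = 1 -> K c -> K d -> det2 c e = l%:Z ->
    det2 d e = - h%:Z ->
    u * (h%:Z * det2 f c + l%:Z * det2 f d) <= k%:Z * (h + l)%N%:Z.
  move=> uu Kc Kd cl dh.
  have [|e' [_ [m [_ ue /andP[_ mk] Km _]]]] := facet (u *: e).
    by apply: contra_neq e0 => ue; rewrite -[e]scale1r -uu -scalerA ue scaler0.
  have cross : det2 (h%:Z *: c + l%:Z *: d) e' <= k%:Z * (h + l)%N%:Z.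
    rewrite det2Dl !det2Zl; have := Km _ Kc; have := Km _ Kd; nia.
  have cdE : h%:Z *: c + l%:Z *: d =
      (u * (h%:Z * det2 f c + l%:Z * det2 f d)) *: (u *: e).
    rewrite (det2_basis (h%:Z *: c + l%:Z *: d) fe).
    rewrite !(det2Dl, det2Dr, det2Zl, det2Zr).
    by rewrite cl dh mulrN mulrC subrr scale0r add0r scalerA mulrAC uu mul1r.
  move: cross; rewrite cdE det2Zl; set A := u * _ => cross.
  have [A0|/ltW A0] := leP 0 A; last exact: le_trans A0 _.
  by apply: le_trans cross; rewrite ler_peMr// -gtz0_ge1.
(* The right ends ([u = 1]) and the left ends ([u = -1]) together give
   [h N + l B <= 2 k (h + l)]. *)
have w1 := width 1 a' b' (mulr1 1) Ka' Kb' a'l b'h.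
have w2 := width (-1) a b (mulrNN 1 1) Ka Kb al bh.
have h0 : (0 < h)%N by lia.
have l0 : (0 < l)%N by lia.
apply: (@boundary_arith k l h (size S) _ _ (det2 f a' - det2 f a)
  (det2 f b' - det2 f b)) aa bb _ _ _ => //.
- by lia.
- apply: count_levels => // z /SK Kz; by rewrite Kv_min// Kl.
- move=> kh; rewrite -lez_nat.
  have := @weighted_count_levels _ S (fun z => det2 z e) k l l0.
  rewrite -det2_sum => bound; move: se; suff: k%:Z * (size S)%:Z +
      det2 (\sum_(z <- S) z) e <= ((k + l) * (k + l - 1 +
        count [pred z | det2 z e == l%:Z] S))%N%:Z by clear; lia.
  by apply: bound => [z /SK/Kl//|i il]; apply: level2; lia.
Qed.

(** * Closures, interiors and convexity in the plane *)

Section Plane.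
Variable R : archiRealFieldType.
Implicit Types (A Q : set 'cV[R]_2) (a b c e p s x y z : 'cV[R]_2).

Lemma nbhs_colP z A : nbhs z A <-> exists2 eps : R, 0 < eps &
  forall y, (forall i, `|z i ord0 - y i ord0| < eps) -> A y.
Proof.
rewrite nbhs_ballP; split=> -[eps e0 H]; exists eps => // y zy; apply: H.
  by split=> // i j; rewrite ord1 -ball_normE; exact: zy.
by case: zy => _ zy i; have := zy i ord0; rewrite -ball_normE.
Qed.

Lemma closure_colP A z : closure A z <-> forall eps : R, 0 < eps ->
  exists2 y, A y & forall i, `|z i ord0 - y i ord0| < eps.
Proof.
split=> [cl eps e0|near B /nbhs_colP[eps e0 epsB]].
  have [|y [Ay zy]] := cl [set y | forall i, `|z i ord0 - y i ord0| < eps].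
    by apply/nbhs_colP; exists eps.
  by exists y.
by have [y Ay /epsB By] := near _ e0; exists y.
Qed.

Lemma convex_setP A : convex_set A <-> forall x y (t : R),
  A x -> A y -> 0 <= t <= 1 -> A (t *: x + (1 - t) *: y).
Proof.
split=> [cA x y t Ax Ay t01|cA x y t].
  have t01' : Itv.spec (@Itv.num_sem R) (Itv.Real `[0%Z, 1%Z]) t.
    by rewrite /= /Itv.num_sem /= in_itv /= num_real.
  by have /(_ x y (Itv.mk t01')) := cA; rewrite !inE; apply.
by rewrite !inE => Ax Ay; apply: cA => //; rewrite ge0 le1.
Qed.

Lemma convex_conv_hull A : convex_set (conv_hull A).
Proof.
apply/convex_setP => x y t Ax Ay t01 B [cB AB].
by move/convex_setP: (cB) => cB'; apply: cB' t01; [exact: (Ax B)|exact: (Ay B)].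
Qed.

Lemma conv_hull_halfplane A e (c : R) :
    (forall x, A x -> det2 x e <= c) ->
  forall x, conv_hull A x -> det2 x e <= c.
Proof.
move=> Ac; apply: (@smallest_sub _ _ _ [set x | det2 x e <= c]) => //.
apply/convex_setP => x y t /= xc yc /andP[t0 t1].
by rewrite det2Dl !det2Zl; nra.
Qed.

Lemma closure_halfplane A e (c : R) :
    (forall x, A x -> det2 x e <= c) ->
  forall x, closure A x -> det2 x e <= c.
Proof.
move=> Ac x /closure_colP clx; rewrite leNgt; apply/negP => cx.
(* [M] is a Lipschitz constant of [det2 _ e] for the maximum norm; the summand 1 makes it
   positive. *)
pose M := 1 + `|e ord0 ord0| + `|e ord_max ord0|.
have M0 : 0 < M by rewrite /M; have := normr_ge0 (e ord0 ord0);
  have := normr_ge0 (e ord_max ord0); lra.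
have [|y /Ac yc xy] := clx ((det2 x e - c) / M).
  by rewrite divr_gt0 ?subr_gt0.
have : `|det2 x e - det2 y e| < det2 x e - c.
  have -> : det2 x e - det2 y e = (x ord0 ord0 - y ord0 ord0) * e ord_max ord0
      - (x ord_max ord0 - y ord_max ord0) * e ord0 ord0 by rewrite /det2; ring.
  apply: le_lt_trans (ler_normB _ _) _; rewrite !normrM.
  have := xy ord0; have := xy ord_max; set d := _ / M => h1 h0.
  have -> : det2 x e - c = d * M by rewrite /d divfK ?gt_eqF.
  have := normr_ge0 (e ord0 ord0); have := normr_ge0 (e ord_max ord0).
  have := normr_ge0 (x ord0 ord0 - y ord0 ord0); rewrite /M.
  move: `|_| `|_| h0 h1 => *; nra.
by move=> /(le_lt_trans (ler_norm _)); lra.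
Qed.

Lemma convex_closure A : convex_set A -> convex_set (closure A).
Proof.
move=> /convex_setP cA; apply/convex_setP => x y t.
move=> /closure_colP clx /closure_colP cly /[dup] t01 /andP[t0 t1].
apply/closure_colP => eps e0.
have e2 : 0 < eps / 2 by rewrite divr_gt0.
have [x' Ax xx] := clx _ e2; have [y' Ay yy] := cly _ e2.
exists (t *: x' + (1 - t) *: y') => [|i]; first exact: cA.
have -> : (t *: x + (1 - t) *: y) i ord0 - (t *: x' + (1 - t) *: y') i ord0 =
    t * (x i ord0 - x' i ord0) + (1 - t) * (y i ord0 - y' i ord0).
  by rewrite !mxE; ring.
have := yy i; have := xx i.
move: (x i ord0 - x' i ord0) (y i ord0 - y' i ord0) => z w.
rewrite !ltr_norml => /andP[z1 z2] /andP[w1 w2].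
have : 0 <= t * (eps / 2 - z) by rewrite mulr_ge0//; lra.
have : 0 <= t * (z + eps / 2) by rewrite mulr_ge0//; lra.
have : 0 <= (1 - t) * (eps / 2 - w) by rewrite mulr_ge0//; lra.
have : 0 <= (1 - t) * (w + eps / 2) by rewrite mulr_ge0//; lra.
lra.
Qed.

(** As [x] may lie outside [A], take [y] in [A] close to it: a point [z] near [t x] is
    [t y + (1 - t) w] with [w = (z - t y) / (1 - t)] near the origin, hence in [A]. *)
Lemma convex_interior_shrink A x (t : R) : convex_set A -> interior A 0 ->
  closure A x -> 0 <= t < 1 -> interior A (t *: x).
Proof.
move=> /convex_setP cA /nbhs_colP[eps e0 eA] /closure_colP clx /andP[t0 t1].
have u0 : 0 < (1 - t) * eps / 2 by rewrite divr_gt0// mulr_gt0// subr_gt0.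
have [y Ay xy] := clx _ u0.
apply/nbhs_colP; exists ((1 - t) * eps / 2) => // z zx.
have t1' : 1 - t != 0 by rewrite subr_eq0 gt_eqF.
have -> : z = t *: y + (1 - t) *: ((1 - t)^-1 *: (z - t *: y)).
  by rewrite scalerA mulfV// scale1r addrC subrK.
apply: cA; [by []| |by rewrite t0 ltW].
apply: eA => i; rewrite !mxE sub0r normrN normrM.
rewrite gtr0_norm ?invr_gt0 ?subr_gt0// mulrC ltr_pdivrMr ?subr_gt0//.
have := zx i; have := xy i; rewrite !mxE !ltr_norml; nra.
Qed.

Lemma ray_in_interior A s : interior A 0 -> exists2 t : R, 0 < t & A (t *: s).
Proof.
move=> /nbhs_colP[eps e0 eA].
pose M := 1 + `|s ord0 ord0| + `|s ord_max ord0|.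
have s0 := normr_ge0 (s ord0 ord0); have s1 := normr_ge0 (s ord_max ord0).
have M0 : 0 < M by rewrite /M; lra.
exists (eps / M); first by rewrite divr_gt0.
apply: eA => i; rewrite !mxE sub0r normrN normrM gtr0_norm ?divr_gt0//.
rewrite -mulrA mulrC -[ltRHS]mul1r ltr_pM2r// mulrC ltr_pdivrMr// mul1r /M.
have [->|->] : i = ord0 \/ i = ord_max; last 2 first; [lra|lra|].
by case: i => -[|[|//]] ?; [left|right]; apply: val_inj.
Qed.

(* For small [t], the point [b + t *: d] lies between [p] and a point
   [b + z *: e] with [- x <= z <= y]. *)
Lemma convex_push A b e p d (r x y u : R) : convex_set A ->
    0 < x -> 0 < y -> A (b - x *: e) -> A (b + y *: e) -> A p -> 0 <= r ->
    d = u *: e + r *: (p - b) ->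
  exists2 t : R, 0 < t & A (b + t *: d).
Proof.
move=> /convex_setP cA x0 y0 Ax Ay Ap r0 ->.
pose m := Num.min x y; have m0 : 0 < m by rewrite /m lt_min x0 y0.
have mx : m <= x by rewrite /m ge_min lexx.
have my : m <= y by rewrite /m ge_min lexx orbT.
have u0 := normr_ge0 u.
have M0 : 0 < 2 * (`|u| + r * m + 1) by nra.
(* This choice ensures [t r <= 1/2] and [t |u| <= m/2], whence [|z| <= m] below. *)
pose t := m / (2 * (`|u| + r * m + 1)).
have t0 : 0 < t by rewrite divr_gt0.
have tM : t * (2 * (`|u| + r * m + 1)) = m by rewrite divfK ?gt_eqF.
have rt0 : 0 <= t * r by rewrite mulr_ge0// ltW.
have rt : t * r <= 1 / 2.
  rewrite -(ler_pM2r m0) -[leRHS]mulr1; nra.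
pose z := t * u / (1 - t * r).
have rt1 : 0 < 1 - t * r by lra.
have zm : `|z| <= m.
  rewrite /z normrM normfV normrM (gtr0_norm t0) (gtr0_norm rt1) ler_pdivrMr//.
  nra.
have {}zm : - m <= z <= m by rewrite -ler_norml.
have Az : A (b + z *: e).
  have -> : b + z *: e = ((z + x) / (x + y)) *: (b + y *: e)
      + (1 - (z + x) / (x + y)) *: (b - x *: e).
    have xy0 : x + y != 0 by rewrite gt_eqF// addr_gt0.
    by apply: col2P; rewrite !mxE; field.
  apply: cA => //; rewrite divr_ge0 ?ler_pdivrMr ?addr_gt0//; lra.
exists t => //.
have -> : b + t *: (u *: e + r *: (p - b)) =
    (t * r) *: p + (1 - t * r) *: (b + z *: e).
  have rt1' : 1 - t * r != 0 by rewrite gt_eqF.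
  by apply: col2P; rewrite !mxE /z; field.
by apply: cA => //; lra.
Qed.

End Plane.

Lemma card_seq_le (T : eqType) (s : seq T) n :
  (size s <= n)%N -> ([set` s] #<= `I_n)%card.
Proof.
case: s => [|x0 s] sn.
  suff -> : [set` [::]] = set0 :> set T by exact: card_ge0.
  by apply/seteqP; split.
apply: card_le_trans (subset_card_le _) (card_image_le (nth x0 (x0 :: s)) `I_n).
move=> x /= xs; exists (index x (x0 :: s)); last exact: nth_index.
by apply: leq_trans sn; rewrite index_mem.
Qed.

(** * Lattice polygons around the origin *)

Section Polygon.
Variables (R : archiRealFieldType) (V : seq 'cV[int]_2).
Notation emb := (@lattice_emb R 2 1).
Let Q : set 'cV[R]_2 := conv_hull [set emb z | z in [set` V]].
Hypothesis Q0 : interior Q 0.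
Implicit Types (e f s z : 'cV[int]_2).

Lemma det2_emb e f : det2 (emb e) (emb f) = (det2 e f)%:~R.
Proof. by rewrite /det2 !mxE rmorphB !rmorphM. Qed.

Lemma hull_generator v : v \in V -> Q (emb v).
Proof. by move=> vV; apply: sub_gen_smallest; exists v. Qed.

Lemma hull_le e (c : int) : (forall v, v \in V -> det2 v e <= c) ->
  forall x, Q x -> det2 x (emb e) <= c%:~R.
Proof.
move=> Vc; apply: conv_hull_halfplane => _ [v vV <-].
by rewrite det2_emb ler_int; exact: Vc.
Qed.

Lemma closure_hull_le e (c : int) : (forall v, v \in V -> det2 v e <= c) ->
  forall z, closure Q (emb z) -> det2 z e <= c.
Proof.
by move=> /hull_le/closure_halfplane Qc z /Qc; rewrite det2_emb ler_int.
Qed.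

Lemma hull_det2_gt0 e : e != 0 -> exists2 x, Q x & 0 < det2 x (emb e).
Proof.
(* [w] is [e] turned by a right angle, so [det2 w e] is the squared length of [e]. *)
move=> e0; pose w := col2 (e ord_max ord0) (- e ord0 ord0).
have we : 0 < det2 w e.
  rewrite det2C det2_col2 opprB mulrN opprK lt_neqAle eq_sym.
  rewrite addr_ge0 -?expr2 ?sqr_ge0// andbT.
  apply: contraNneq e0 => /eqP; rewrite paddr_eq0 -?expr2 ?sqr_ge0//.
  rewrite !sqrf_eq0 => /andP[/eqP e1 /eqP e00].
  by apply/eqP; apply: col2P; rewrite mxE.
have [t t0 Qt] := ray_in_interior (emb w) Q0.
by exists (t *: emb w) => //; rewrite det2Zl det2_emb mulr_gt0// ltr0z.
Qed.

Lemma generators_nil : V != [::].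
Proof.
apply/eqP => V0.
have [|x Qx] := @hull_det2_gt0 (col2 1 0).
  by apply/eqP => /matrixP/(_ ord0 ord0); rewrite !mxE.
rewrite ltNge (@hull_le _ 0)// => v; by rewrite V0.
Qed.

Lemma generator_max e : e != 0 -> exists v, [/\ v \in V, 0 < det2 v e &
  forall v', v' \in V -> det2 v' e <= det2 v e].
Proof.
move=> e0; have [v vV vmax] := seq_argmax (fun v => det2 v e) generators_nil.
exists v; split=> //; have [x Qx x0] := hull_det2_gt0 e0.
by rewrite -(ltr0z R); apply: lt_le_trans x0 (hull_le vmax Qx).
Qed.

(* An edge is represented by its direction [e], and its normal functional by
   [det2 _ e]. *)
Definition row_of e : 'rV[int]_2 :=
  \row_j (if j == ord0 then e ord_max ord0 else - e ord0 ord0).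

Lemma pairing_row_of e x :
  pairing (lattice_emb R (row_of e)) x = det2 x (emb e).
Proof.
rewrite /pairing mxE !big_ord_recl big_ord0 addr0 /det2 !mxE /=.
rewrite (_ : lift ord0 ord0 = ord_max); last exact: val_inj.
by rewrite rmorphN mulNr mulrC [in X in _ - X]mulrC.
Qed.

(** A lattice point equal to [t] times [row_of e] would take the value [t] at [f], an integer
    strictly between 0 and 1. *)
Lemma primitive_row_of e f : det2 f e = 1 -> primitive R (row_of e).
Proof.
move=> fe; split.
  apply: contra_eq_neq fe => /matrixP e0.
  have := e0 ord0 ord0; have := e0 ord0 ord_max.
  rewrite !mxE /= => /eqP; rewrite oppr_eq0 => /eqP e00 e01.
  by rewrite /det2 e00 e01 !mulr0 subrr eq_sym oner_eq0.
move=> w t t0 t1 wt.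
have : ((w *m f) ord0 ord0)%:~R = t :> R.
  have -> : t = pairing (lattice_emb R w) (emb f).
    rewrite wt /pairing -scalemxAl mxE -/(pairing _ _) pairing_row_of.
    by rewrite det2_emb fe mulr1.
  by rewrite /pairing /lattice_emb -map_mxM [RHS]mxE.
by move=> wf; move: t0 t1; rewrite -wf ltr0z ltrz1; lia.
Qed.

(** As 0 is interior, generators lie on both sides of the line of [s], and [hull_edge] gives an edge
    whose outer normal is positive at [s]. Its height is a local index, hence at most [k]. *)
Lemma facet_in_direction (k : int) s : max_local_index Q k -> s != 0 ->
  exists e f (l : int), [/\ det2 f e = 1, 0 < det2 s e, 0 < l <= k,
    forall z, closure Q (emb z) -> det2 z e <= l &
    exists2 p, closure Q (emb p) & det2 p e = l].
Proof.
move=> [_ maxk] s0.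
have [a [aV a0 _]] := generator_max s0.
have [|b [bV b0 _]] := @generator_max (- s); first by rewrite oppr_eq0.
have [|p [q [pV qV spq pmax]]] := @hull_edge s V.
  exists a, b; split=> //; move: b0.
  rewrite -scaleN1r det2Zr mulN1r oppr_gt0 !(det2C s) ltrN2 => /lt_trans; exact.
have d0 : p - q != 0 by apply: contraTneq spq => ->; rewrite det2C det20l oppr0.
have [g [e [f [g0 dE fe]]]] := primitive_part d0.
have emax v : v \in V -> det2 v e <= det2 p e.
  by move=> /pmax; rewrite dE !det2Zr ler_pM2l.
have qe : det2 q e = det2 p e.
  apply/eqP; rewrite eq_sym -subr_eq0 -det2Bl dE det2Zl.
  by rewrite [det2 e e](_ : _ = 0) ?mulr0// /det2 mulrC subrr.
have e0 : e != 0 by apply: contraNneq d0 => e0; rewrite dE e0 scaler0.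
have l0 : 0 < det2 p e.
  have [x Qx x0] := hull_det2_gt0 e0.
  by rewrite -(ltr0z R); apply: lt_le_trans x0 (hull_le emax Qx).
pose F := Q `&` [set x | pairing (lattice_emb R (row_of e)) x = (det2 p e)%:~R].
have supF : supports Q (lattice_emb R (row_of e)) (det2 p e)%:~R F.
  by split=> // x Qx; rewrite pairing_row_of hull_le.
exists e, f, (det2 p e); split=> //.
- by move: spq; rewrite dE det2Zr pmulr_rgt0.
- rewrite l0 /=; apply: (maxk F).
    split; first by exists (lattice_emb R (row_of e)), (det2 p e)%:~R.
      move=> FQ; have : F 0 by rewrite FQ; apply: interior_subset Q0.
      case=> _ /=; rewrite pairing_row_of det20l => /eqP.
      by rewrite eq_sym intr_eq0 gt_eqF.
    exists (emb p), (emb q); split.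
    + by split; [exact: hull_generator|rewrite /= pairing_row_of det2_emb].
    + by split; [exact: hull_generator|rewrite /= pairing_row_of det2_emb qe].
    + apply: contraNneq d0 => /matrixP pq; rewrite subr_eq0.
      by apply/eqP/matrixP => i j; have := pq i j; rewrite !mxE => /intr_inj.
  exists (row_of e); split; last by move=> x [].
  by split; [exact: primitive_row_of fe|exists (det2 p e)%:~R].
- exact: closure_hull_le.
- by exists p => //; apply: subset_closure; exact: hull_generator.
Qed.

Lemma hull_min e : e != 0 -> exists v, [/\ closure Q (emb v), det2 v e < 0 &
  forall z, closure Q (emb z) -> det2 v e <= det2 z e].
Proof.
move=> e0; have [|v [vV v0 vmax]] := @generator_max (- e).
  by rewrite oppr_eq0.
have N z : det2 z (- e) = - det2 z e by rewrite -scaleN1r det2Zr mulN1r.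
exists v; split.
- by apply: subset_closure; exact: hull_generator.
- by move: v0; rewrite N oppr_gt0.
- by move=> z /(closure_hull_le vmax); rewrite !N lerN2.
Qed.

(** [b] lies inside a segment of the closure parallel to [e], with [p] above and [v] below, so it
    can be moved slightly in any direction. *)
Lemma interior_between e f b (x y : int) p v : det2 f e = 1 -> 0 < x -> 0 < y ->
    closure Q (emb (b - x *: e)) -> closure Q (emb (b + y *: e)) ->
    closure Q (emb p) -> closure Q (emb v) ->
    det2 v e < det2 b e < det2 p e ->
  interior Q (emb b).
Proof.
move=> fe x0 y0 Qbx Qby Qp Qv /andP[vb bp].
have cQ : convex_set Q by exact: convex_conv_hull.
(* Pushing [b] away from the interior point 0 stays in the closure. *)
suff [t t0 Qt] : exists2 t : R, 0 < t & closure Q (emb b + t *: emb b).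
  have -> : emb b = (1 + t)^-1 *: (emb b + t *: emb b).
    rewrite -{2}[emb b]scale1r -scalerDl scalerA mulVf ?scale1r// gt_eqF//.
    by lra.
  apply: convex_interior_shrink => //.
  by rewrite invr_ge0 invf_lt1; lra.
(* [r (w - b)] has the height of [b], so it differs from [b] by a multiple of [e], as [convex_push]
   requires. *)
have push w (r : R) : closure Q (emb w) -> 0 <= r ->
    r * (det2 w e - det2 b e)%:~R = (det2 b e)%:~R ->
    exists2 t : R, 0 < t & closure Q (emb b + t *: emb b).
  move=> Qw r0 rE.
  have bE : emb b = det2 (emb f) (emb b - r *: (emb w - emb b)) *: emb e
      + r *: (emb w - emb b).
    have fe' : det2 (emb f) (emb e) = 1 :> R by rewrite det2_emb fe.
    rewrite -[LHS](subrK (r *: (emb w - emb b))); congr (_ + _).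
    rewrite [LHS](det2_basis _ fe') [X in X *: _](_ : _ = 0) ?scale0r ?add0r//.
    by rewrite det2Bl det2Zl det2Bl !det2_emb -rmorphB rE subrr.
  have xR : 0 < x%:~R :> R by rewrite ltr0z.
  have yR : 0 < y%:~R :> R by rewrite ltr0z.
  have Kx : closure Q (emb b - x%:~R *: emb e).
    suff <- : emb (b - x *: e) = emb b - x%:~R *: emb e by [].
    by apply/matrixP => i j; rewrite !mxE rmorphB rmorphM.
  have Ky : closure Q (emb b + y%:~R *: emb e).
    suff <- : emb (b + y *: e) = emb b + y%:~R *: emb e by [].
    by apply/matrixP => i j; rewrite !mxE rmorphD rmorphM.
  exact: (convex_push (convex_closure cQ) xR yR Kx Ky Qw r0 bE).
(* Moving away from the origin never lowers a nonnegative height, so [p] serves; it lowers a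
   negative one, so [v] serves. *)
have [b0|b0] := leP 0 (det2 b e).
- apply: (push p ((det2 b e)%:~R / (det2 p e - det2 b e)%:~R)) => //.
    by rewrite divr_ge0// ler0z// ltW// subr_gt0.
  by rewrite divfK// intr_eq0 subr_eq0 gt_eqF.
- apply: (push v ((det2 b e)%:~R / (det2 v e - det2 b e)%:~R)) => //.
    by rewrite -mulrNN -invrN -!rmorphN divr_ge0// ler0z; lia.
  by rewrite divfK// intr_eq0 subr_eq0 lt_eqF.
Qed.

(** Each coordinate and its negative is some [det2 _ e], bounded on the closure by its maximum over
    the generators; a finite box remains. *)
Lemma finite_boundary_points : finite_set (boundary_points Q).
Proof.
have bound e : e != 0 ->
    exists M : int, forall z, closure Q (emb z) -> det2 z e <= M.
  by move=> /generator_max[v [_ _ /closure_hull_le]]; exists (det2 v e).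
have col2_neq0 a b : (a != 0) || (b != 0) -> col2 a b != 0.
  apply: contraTneq => /matrixP E; have := E ord0 ord0; have := E ord_max ord0.
  by rewrite !mxE /= => -> ->; rewrite eqxx.
have [M1 H1] := bound (col2 0 1) (col2_neq0 0 1 isT).
have [M2 H2] := bound (col2 0 (-1)) (col2_neq0 0 (-1) isT).
have [M3 H3] := bound (col2 1 0) (col2_neq0 1 0 isT).
have [M4 H4] := bound (col2 (-1) 0) (col2_neq0 (-1) 0 isT).
have bounds z : closure Q (emb z) ->
    - M2 <= z ord0 ord0 <= M1 /\ - M3 <= z ord_max ord0 <= M4.
  move=> cz; have := H1 _ cz; have := H2 _ cz; have := H3 _ cz; have := H4 _ cz.
  rewrite !det2_col2 !(mulr0, mulr1, mulrN1, subr0, sub0r, opprK).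
  by rewrite !(lerNl _ (z _ _)) => -> -> -> ->.
pose r (a b : int) := [seq (a + i%:Z)%R | i <- iota 0 `|(b - a + 1)%R|].
have rP a b c : a <= c <= b -> c \in r a b.
  move=> acb; have -> : c = a + `|(c - a)%R|%N by lia.
  by apply: map_f; rewrite mem_iota /=; lia.
pose box := [seq col2 a b | a <- r (- M2) M1, b <- r (- M3) M4].
apply: sub_finite_set (finite_seq box).
move=> z [cz _] /=; apply/allpairsP; exists (z ord0 ord0, z ord_max ord0) => /=.
by have [/rP ? /rP ?] := bounds _ cz; split=> //; apply: col2P; rewrite !mxE.
Qed.

End Polygon.

(** * The three bounds *)

Lemma card_boundary_points (R : archiRealFieldType) (Q : set 'cV[R]_2)
    (k n : nat) :
    IP_polygon Q -> max_local_index Q k -> (2 <= k)%N ->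
    (maxn (12 * k) (2 * k * (k + 3) - 2) <= n)%N ->
  (boundary_points Q #<= `I_n)%card.
Proof.
move=> [[[V QE] _] Q0] maxk k2 kn; rewrite {}QE in Q0 maxk *.
have /finite_seqP[S0 SE] := finite_boundary_points Q0.
pose S := undup S0.
have SP z : z \in S -> boundary_points (conv_hull
    [set lattice_emb R v | v in [set` V]]) z by rewrite SE /= mem_undup.
rewrite SE (_ : [set` S0] = [set` S]); last first.
  by apply/seteqP; split=> z /=; rewrite mem_undup.
apply: card_seq_le; apply: leq_trans kn.
apply: (@lattice_bound k (fun z => closure (conv_hull
  [set lattice_emb R v | v in [set` V]]) (lattice_emb R z)) S) => //.
- exact: undup_uniq.
- by move=> z /SP[].
- by move=> s; exact: facet_in_direction.
- by move=> e; exact: hull_min.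
move=> e f b x y p v fe x0 y0 Kx /SP[_ nb] Ky Kp Kv vbp.
by apply: nb; exact: (interior_between Q0 fe x0 y0 Kx Ky Kp Kv vbp).
Qed.

(* #<= compares cardinals: A #<= `I_n says that A is finite with at most n
   elements. *)
Theorem theorem4p4 (R : archiRealFieldType) (Q : set 'cV[R]_2) (k : nat)
    (HQ : IP_polygon Q) (Hm : max_local_index Q (Posz k)) (Hk : (2 <= k)%N) :
  [/\ (boundary_points Q #<= `I_(4 * k * (k + 2)))%card,
      LDP_polygon Q ->
        (boundary_points Q #<= `I_(4 * k * (k + 2) - 2))%card
    & LDP_polygon Q -> (3 <= k)%N -> prime k ->
        (boundary_points Q #<= `I_(4 * k * (k + 1) - 2))%card].
Proof.
(* Both terms of the maximum are at most [4 k (k + 2) - 2] for [k >= 2], and at most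
   [4 k (k + 1) - 2] for [k >= 3]; at [k = 2] the term [12 k = 24] would exceed the latter, 22. *)
by split=> *; apply: (card_boundary_points HQ Hm Hk); rewrite geq_max; nia.
Qed.
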